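(* Let $n\ge r$ and $\varphi\in\mathscr P_n\setminus\mathscr P_{r-1}$, and let $\{\varphi_j\}_{1\le j\le r}$ be any basis of $H^0(\mathcal X\otimes\sqrt{\mathcal K}(\Xi))$. Then the following two statements hold. [1] There is an expansion $$\varphi(p)=\sum_{j=1}^r f_j(z)\,\varphi_j(p),\qquad z=Z(p),$$ where the $f_j$ are polynomials of degree $\le\lfloor n/r\rfloor$ and at least one of them is of degree exactly $\lfloor n/r\rfloor$. [2] Let $\{\psi_\ell\}_{\ell\ge0}$ be an arbitrary sequence such that $\psi_\ell$ spans $\mathscr P_\ell$ modulo $\mathscr P_{\ell-1}$, and arrange the coefficients of the expansions as in [1] of $\psi_{kr},\dots,\psi_{kr+r-1}$ with respect to the basis $\psi_0,\dots,\psi_{r-1}$ of $H^0(\mathcal X\otimes\sqrt{\mathcal K}(\Xi))$ in matrix form: $$\begin{bmatrix}\psi_{kr}(p)\\ \vdots\\ \psi_{kr+r-1}(p)\end{bmatrix}=F^{(k)}(z)\begin{bmatrix}\psi_0(p)\\ \vdots\\ \psi_{r-1}(p)\end{bmatrix},\qquad z=Z(p).$$ Then $F^{(k)}(z)$ is a polynomial ($r\times r$) matrix of degree $k$ in the indeterminate $z$ and its leading coefficient matrix (the coefficient of $z^k$) is invertible.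
   Context: $\mathcal C$ is a compact Riemann surface of genus $g$ with canonical bundle $\mathcal K$, and $\sqrt{\mathcal K}$ is a fixed holomorphic square root of $\mathcal K$ with $h^0(\sqrt{\mathcal K})=0$. $\mathcal X$ is a flat line bundle given by a unitary character $\mathcal X:\pi_1(\mathcal C)\to U(1)$, with the standing assumption $h^0(\mathcal X\otimes\sqrt{\mathcal K})=0$. For a divisor $\mathscr D$, $H^0(\mathcal X\otimes\sqrt{\mathcal K}(\mathscr D))$ is the space of meromorphic sections $\varphi$ of $\mathcal X\otimes\sqrt{\mathcal K}$ with $\mathrm{div}(\varphi)\ge-\mathscr D$; its dimension is $\deg\mathscr D$ for positive $\mathscr D$. $Z:\mathcal C\to\mathbb C\mathbb P^1$ is a meromorphic function of degree $r$ with polar divisor $\Xi$ ($\deg\Xi=r$). $\mathscr D_n$ is a strictly increasing sequence of positive divisors, $\deg\mathscr D_n=n$, of the form $\mathscr D_{kr+\ell}=k\Xi+\mathscr R_\ell$ for $k\ge0$, $0\le\ell\le r-1$, where $\mathscr R_\ell$ is a positive divisor of degree $\ell$ with $\mathscr R_\ell\le\Xi$ ($\mathscr R_0=0$). Set $\mathscr P_n:=H^0(\mathcal X\otimes\sqrt{\mathcal K}(\mathscr D_{n+1}))$, so that $\dim\mathscr P_n=n+1$, $\mathscr P_{n-1}\subset\mathscr P_n$ ($\mathscr P_{-1}=\{0\}$), and $\mathscr P_{r-1}=H^0(\mathcal X\otimes\sqrt{\mathcal K}(\Xi))$.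
   Formalization: In [1], that some f_j has degree exactly ⌊n/r⌋ is asserted only for φ not in P_{r⌊n/r⌋-1}; as printed it fails for n≥2r (genus 0, r=1, Z=z, n=2, φ=zφ_1 has degree 1). The condition is necessary, and for r≤n<2r it is the original one. *)

(* Defs.v *)
From HB Require Import structures.
From mathcomp Require Import all_boot all_order all_algebra.
From mathcomp Require Import complex.
From mathcomp Require Import all_classical all_reals all_analysis.

Set Implicit Arguments.
Unset Strict Implicit.
Unset Printing Implicit Defensive.

Import Order.TTheory GRing.Theory Num.Theory.
Import numFieldNormedType.Exports.

Local Open Scope classical_set_scope.
Local Open Scope complex_scope.
Local Open Scope ring_scope.

(* A compact (connected, Hausdorff) Riemann surface with a holomorphic atlas.
   As [dom j] is open, [transition] says that [chart j \o (chart i)^-1] is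
   complex analytic: near [p], [chart j] is a convergent power series in the
   local coordinate [chart i q - chart i p].  [chart_at p] is a preferred chart
   around [p]; the notions below that are read in it do not depend on it. *)
Record compactRiemannSurface (R : realType) := CompactRiemannSurface {
  surface :> topologicalType;
  hausdorff_surface : hausdorff_space surface;
  compact_surface : compact [set: surface];
  connected_surface : connected [set: surface];
  chart_index : Type;
  dom : chart_index -> set surface;
  chart : chart_index -> surface -> R[i]^o;
  chart_at : surface -> chart_index;
  chart_atP : forall p, dom (chart_at p) p;
  open_dom : forall i, open (dom i);
  chart_continuous : forall i, {within dom i, continuous (chart i)};
  chart_inj : forall i p q, dom i p -> dom i q -> chart i p = chart i q -> p = q;
  chart_open : forall i (A : set surface),
    open A -> A `<=` dom i -> open (chart i @` A);
  transition : forall i j p, dom i p -> dom j p ->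
    exists c : nat -> R[i], \forall q \near p,
      series (fun k => c k * (chart i q - chart i p) ^+ k : R[i]^o) @ \oo
        --> chart j q
}.

Section LocalNotions.
Variables (R : realType) (M : compactRiemannSurface R).
Implicit Types (i j : chart_index M) (p q : M) (f : M -> R[i]).

Definition coord i p q : R[i] := chart i q - chart i p.

(* [f] is holomorphic at [p] (for [dom i p]). *)
Definition holo_at i f p : Prop :=
  exists c : nat -> R[i], \forall q \near p,
    series (fun k => c k * coord i p q ^+ k : R[i]^o) @ \oo --> (f q : R[i]^o).

(* [f] is meromorphic at [p], with [ord_p f >= n], resp. [ord_p f = n].  Only
   the values of [f] on a punctured neighbourhood of [p] matter. *)
Definition ord_ge f p (n : int) : Prop :=
  exists h : M -> R[i], holo_at (chart_at p) h p /\
    \forall q \near p^', f q = coord (chart_at p) p q ^ n * h q.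

Definition ord_eq f p (n : int) : Prop :=
  exists h : M -> R[i], [/\ holo_at (chart_at p) h p, h p != 0 &
    \forall q \near p^', f q = coord (chart_at p) p q ^ n * h q].

Definition divisor := M -> int.
Implicit Types D E : divisor.

Definition positive_divisor D : Prop :=
  finite_set [set p | D p != 0] /\ forall p, 0 <= D p.

Definition div_le D E : Prop := forall p, D p <= E p.

Definition div_deg D : int := \sum_(p \in [set: M]) D p.

(* [Z] is a meromorphic function (its values at its poles are irrelevant) and
   [Xi p = max(0, - ord_p Z)]. *)
Definition polar_divisor (Z : M -> R[i]) (Xi : divisor) : Prop :=
  positive_divisor Xi /\
  forall p, ord_ge Z p (- Xi p) /\ (0 < Xi p -> ord_eq Z p (- Xi p)).

(* Holomorphic line bundles are given by transition functions over the atlas;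
   a section is a family of functions with [phi i = g i j * phi j] on
   [dom i `&` dom j].  This loses no generality, as line bundles on the non-compact
   Riemann surfaces [dom i] are trivial. *)
Definition cocycle := chart_index M -> chart_index M -> M -> R[i].
Implicit Types g h : cocycle.

Definition line_bundle g : Prop :=
  [/\ forall i j p, dom i p -> dom j p -> holo_at i (g i j) p,
      forall i j p, dom i p -> dom j p -> g i j p != 0 &
      forall i j k p, dom i p -> dom j p -> dom k p ->
        g i j p * g j k p = g i k p].

Definition tensor g h : cocycle := fun i j p => g i j p * h i j p.

(* The canonical bundle: [phi i dz_i = phi j dz_j] with transition functions
   [dz_j / dz_i]. *)
Definition canonical_bundle : cocycle := fun i j p =>
  lim ((coord j p q / coord i p q : R[i]^o) @[q --> p^']).

Definition bundle_iso g h : Prop :=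
  exists u : chart_index M -> M -> R[i],
    [/\ forall i p, dom i p -> holo_at i (u i) p,
        forall i p, dom i p -> u i p != 0 &
        forall i j p, dom i p -> dom j p -> u i p * g i j p = h i j p * u j p].

(* Meromorphic sections are handled up to equality on punctured neighbourhoods
   of all points, since their values at poles are meaningless. *)
Definition section := chart_index M -> M -> R[i].

Definition section_eq (phi psi : section) : Prop :=
  forall i p, dom i p -> \forall q \near p^', phi i q = psi i q.

Definition section0 : section := fun _ _ => 0.

(* [H0 g D] is the space of meromorphic sections with [div phi >= - D]. *)
Definition H0 g D : set section := [set phi |
  (forall i j p, dom i p -> dom j p ->
     \forall q \near p^', phi i q = g i j q * phi j q) /\
  (forall p, ord_ge (phi (chart_at p)) p (- D p))].

(* [h0 g = 0] *)
Definition no_holo_section g : Prop :=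
  forall phi, H0 g (fun=> 0) phi -> section_eq phi section0.

Definition is_basis (V : set section) r (b : 'I_r -> section) : Prop :=
  [/\ forall j : 'I_r, V (b j),
      forall a : 'I_r -> R[i],
        section_eq (fun i q => \sum_(j < r) a j * b j i q) section0 ->
        forall j : 'I_r, a j = 0 &
      forall phi, V phi -> exists a : 'I_r -> R[i],
        section_eq phi (fun i q => \sum_(j < r) a j * b j i q)].

(* The class of [psi] is a generator of the line [V / W]. *)
Definition spans_modulo (V W : set section) (psi : section) : Prop :=
  [/\ V psi, ~ W psi &
      forall phi, V phi -> exists a : R[i],
        W (fun i q => phi i q - a * psi i q)].

(* Paths are only considered on [0, 1]. *)
Definition path_from_to (x y : M) (gam : R -> M) : Prop :=
  [/\ {within `[0, 1], continuous gam}, gam 0 = x & gam 1 = y].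

Definition concat (gam del : R -> M) : R -> M :=
  fun t => if t <= 2^-1 then gam (2 * t) else del (2 * t - 1).

(* homotopy relative to the end points *)
Definition homotopic (gam del : R -> M) : Prop :=
  exists H : R * R -> M,
    [/\ {within `[0, 1] `*` `[0, 1], continuous H},
        forall t, 0 <= t <= 1 -> H (0, t) = gam t /\ H (1, t) = del t &
        forall s, 0 <= s <= 1 -> H (s, 0) = gam 0 /\ H (s, 1) = gam 1].

(* Unitary characters of the fundamental group with base point [x0]. *)
Definition unitary_character (x0 : M) (chi : (R -> M) -> R[i]) : Prop :=
  [/\ forall gam, path_from_to x0 x0 gam -> `|chi gam| = 1,
      forall gam del, path_from_to x0 x0 gam -> path_from_to x0 x0 del ->
        homotopic gam del -> chi gam = chi del &
      forall gam del, path_from_to x0 x0 gam -> path_from_to x0 x0 del ->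
        chi (concat gam del) = chi gam * chi del].

(* The line bundle [g] is the flat bundle of the character [chi], whose sections
   are the functions on the universal cover (homotopy classes of paths from
   [x0]) on which loops act through [chi]: [e i] is a frame over [dom i] of the
   latter bundle, and [g] is the cocycle of these frames. *)
Definition flat_bundle_of (x0 : M) (chi : (R -> M) -> R[i]) g : Prop :=
  exists e : chart_index M -> (R -> M) -> R[i],
    [/\ forall i p gam, dom i p -> path_from_to x0 p gam -> e i gam != 0,
        forall i p gam del, dom i p -> path_from_to x0 p gam ->
          path_from_to x0 p del -> homotopic gam del -> e i gam = e i del,
        forall i p lam gam, dom i p -> path_from_to x0 x0 lam ->
          path_from_to x0 p gam -> e i (concat lam gam) = chi lam * e i gam,
        forall i p gam, dom i p -> path_from_to x0 p gam ->
          exists (c : nat -> R[i]) (V : set M), nbhs p V /\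
            forall q sig, path_from_to p q sig ->
              (forall t, 0 <= t <= 1 -> V (sig t)) ->
              series (fun k => c k * coord i p q ^+ k : R[i]^o) @ \oo
                --> (e i (concat gam sig) : R[i]^o) &
        forall i j p gam, dom i p -> dom j p -> path_from_to x0 p gam ->
          e j gam = g i j p * e i gam].

End LocalNotions.
Arguments section {R} M.
Arguments divisor {R} M.
Arguments cocycle {R} M.
Arguments canonical_bundle {R} M.

Definition poly_mx_degree (K : nzRingType) (r d : nat) (F : 'M[{poly K}]_r) :=
  (\max_(i < r) \max_(j < r) size (F i j))%N = d.+1.

(* Main.v *)
Require Import Defs.
From HB Require Import structures.
From mathcomp Require Import all_boot all_order all_algebra.
From mathcomp Require Import complex finmap zify ring.
From mathcomp Require Import all_classical all_reals all_analysis.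

Set Implicit Arguments.
Unset Strict Implicit.
Unset Printing Implicit Defensive.

Import Order.TTheory GRing.Theory Num.Theory.
Local Open Scope classical_set_scope.
Local Open Scope complex_scope.
Local Open Scope ring_scope.

(** Multiplication by [Z ^ k] maps H^0(L(Xi)) to H^0(L((k + 1) Xi)), and
    the point of the proof is that it induces an isomorphism onto the quotient
    H^0(L((k + 1) Xi)) / H^0(L(k Xi)).

    Injectivity is local: if [Z ^ k beta] has poles at most [k Xi], then [beta] has
    no pole at the poles of [Z], so it is a holomorphic section of L and vanishes
    ([H0_mulXn_holo], [lincomb_eq0]).  Surjectivity is a dimension count: H^0(L(Xi))
    has a basis of [r] elements, and the quotient has dimension at most [r], since
    a chain of [r] divisors, each one point larger than the previous one, joins
    [k Xi] to [(k + 1) Xi], and each point adds at most one Laurent coefficient to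
    kill ([H0_codim1], [H0_dependent]).  The Riemann-Roch theorem is not used: bases
    are given, and only upper bounds on dimensions are needed.

    Induction on [m] then shows that the combinations of a basis [b] with
    coefficients [f_j(Z)] of degree less than [m] are exactly the elements of
    H^0(L(m Xi)): [polycomb_expansion], [H0_polycomb] and [polycomb_size].  The
    expansion in the first part and the sharpness of its degree follow at once.  For
    the second part, a row vector in the kernel of the leading coefficient matrix
    would yield a combination of [psi (k r), ..., psi (k r + r - 1)] lying in
    H^0(L(k Xi)), while these sections are independent modulo that space
    ([generators_free], [expansion_lead_unit]).

    Zeros and poles are handled through leading Laurent coefficients in the preferred
    charts ([laurent_lead]).  These are multiplicative and unique because germs of
    holomorphic functions, defined as sums of power series, are closed under
    products ([holoM], from the Cauchy product [pser_mul]) and are determined at a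
    point by their values around it ([holo_punctured0]). *)

(** * Complex power series *)

Section PowerSeries.
Variable R : realType.
Implicit Types (a b c : nat -> R[i]) (z l : R[i]).

(** The power series with coefficients [c] converges at [z], with sum [l]. *)
Definition pser c z l : Prop :=
  series (fun k => c k * z ^+ k : R[i]^o) @ \oo --> (l : R[i]^o).

Lemma pserP c z l : pser c z l <->
  forall e : R[i], 0 < e ->
    \forall n \near \oo, `|l - \sum_(k < n) c k * z ^+ k| < e.
Proof.
split=> [/cvgrPdist_lt h e e0 | h].
  near=> n; have : `|l - series (fun k => c k * z ^+ k : R[i]^o) n| < e.
    by near: n; exact: h.
  by rewrite /series /= big_mkord.
apply/cvgrPdist_lt => e e0; near=> n.
rewrite /series /= big_mkord; near: n; exact: h.
Unshelve. all: by end_near. Qed.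

Lemma pserD a b z l m : pser a z l -> pser b z m ->
  pser (fun k => a k + b k) z (l + m).
Proof.
move=> /pserP ha /pserP hb; apply/pserP => e e0.
have e2 : 0 < e / 2 by rewrite divr_gt0.
near=> n.
have -> : l + m - \sum_(k < n) (a k + b k) * z ^+ k =
   (l - \sum_(k < n) a k * z ^+ k) + (m - \sum_(k < n) b k * z ^+ k).
  under eq_bigr do rewrite mulrDl.
  by rewrite big_split /= opprD addrACA.
apply: (le_lt_trans (ler_normD _ _)); rewrite [e]splitr ltrD //.
  by near: n; exact: ha.
by near: n; exact: hb.
Unshelve. all: by end_near. Qed.

Lemma pser_poly c N z : (forall k, (N <= k)%N -> c k = 0) ->
  pser c z (\sum_(k < N) c k * z ^+ k).
Proof.
move=> c0; apply/pserP => e e0; near=> n.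
have Nn : (N <= n)%N by near: n; exact: nbhs_infty_ge.
rewrite -(subnKC Nn) big_split_ord /= [X in _ - (_ + X)]big1 ?addr0 ?subrr ?normr0 //.
by move=> i _; rewrite c0 ?mul0r // leq_addr.
Unshelve. all: by end_near. Qed.

Lemma pser_at0 c : pser c 0 (c 0%N).
Proof.
apply/pserP => e e0; near=> n.
have n0 : (0 < n)%N by near: n; exact: nbhs_infty_gt.
rewrite -(prednK n0) big_ord_recl expr0 mulr1 big1 ?addr0 ?subrr ?normr0 //.
by move=> i _; rewrite expr0n mulr0.
Unshelve. all: by end_near. Qed.

Lemma pser_unique c z l m : pser c z l -> pser c z m -> l = m.
Proof. by move=> h1 h2; apply: (cvg_unique _ h1 h2); exact: norm_hausdorff. Qed.

Lemma pser_shift c z l : z != 0 -> pser c z l ->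
  pser (fun k => c k.+1) z ((l - c 0%N) / z).
Proof.
move=> z0 /pserP h; apply/pserP => e e0; near=> n.
have -> : (l - c 0%N) / z - \sum_(k < n) c k.+1 * z ^+ k =
   (l - \sum_(k < n.+1) c k * z ^+ k) / z.
  rewrite big_ord_recl expr0 mulr1 opprD addrA [RHS]mulrDl; congr (_ + _).
  rewrite mulNr mulr_suml; congr (- _); apply: eq_bigr => i _.
  by rewrite lift0 exprSr mulrA mulfK.
rewrite normrM normfV ltr_pdivrMr ?normr_gt0 //.
near: n; have : \forall n \near \oo, `|l - \sum_(k < n) c k * z ^+ k| < e * `|z|.
  by apply: h; rewrite mulr_gt0 ?normr_gt0.
case=> N _ hN; exists N => // n /= Nn; apply: hN => /=; exact: leqW.
Unshelve. all: by end_near. Qed.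

(** Each term is a difference of two consecutive partial sums, and these
    converge. *)
Lemma pser_coef_bound c z l : pser c z l ->
  exists2 B : R[i], 0 <= B & forall k, `|c k * z ^+ k| <= B.
Proof.
move=> /pserP /(_ 1 ltr01) [N _ hN].
(* Beyond [N] the partial sums are within 1 of [l], so the terms are at most 2. *)
exists (2 + \sum_(k < N) `|c k * z ^+ k|) => [|k].
  by rewrite addr_ge0 // sumr_ge0.
case: (ltnP k N) => kN.
  rewrite (bigD1 (Ordinal kN)) //= addrCA lerDl.
  by rewrite addr_ge0 // sumr_ge0.
apply: (@le_trans _ _ 2); last by rewrite lerDl sumr_ge0.
have := hN k kN; have := hN k.+1 (leqW kN) => /= h1 h2.
have -> : c k * z ^+ k = (l - \sum_(i < k) c i * z ^+ i) -
    (l - \sum_(i < k.+1) c i * z ^+ i).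
  by rewrite big_ord_recr /=; ring.
apply: (le_trans (ler_normB _ _)).
by have := ltW (ltrD h2 h1).
Qed.

(** Convergence at [z0] makes the terms decay like [8 ^- k] on the disc of
    radius [`|z0| / 8]; the ratio 8 leaves room to absorb the polynomial factors
    that appear in the Cauchy product. *)
Lemma pser_term_le c z0 B z k : `|c k * z0 ^+ k| <= B -> `|z| <= `|z0| / 8 ->
  `|c k * z ^+ k| <= B / 8 ^+ k.
Proof.
move=> hB hz; rewrite ler_pdivlMr ?exprn_gt0 //.
apply: le_trans hB; rewrite !normrM -mulrA ler_wpM2l // !normrX -exprMn.
by rewrite lerXn2r ?nnegrE // ?mulr_ge0 // -ler_pdivlMr.
Qed.

(** A power series is bounded, uniformly on a small disc. *)
Lemma pser_bounded c z0 l0 : pser c z0 l0 ->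
  exists B : R[i], forall z l, `|z| <= `|z0| / 8 -> pser c z l -> `|l| <= B.
Proof.
move=> /pser_coef_bound [B B0 hB]; exists (1 + B * 2) => z l hz /pserP.
move=> /(_ 1 ltr01) [N _ /(_ N (leqnn N)) hN].
rewrite -[l](subrK (\sum_(k < N) c k * z ^+ k)).
apply: (le_trans (ler_normD _ _)); apply: lerD; first exact: ltW.
apply: (le_trans (ler_norm_sum _ _ _)).
apply: (@le_trans _ _ (\sum_(k < N) B / 2 ^+ k)).
  apply: ler_sum => k _; apply: le_trans (pser_term_le (hB k) hz) _.
  rewrite ler_wpM2l // lef_pV2 ?posrE ?exprn_gt0 //.
  by rewrite lerXn2r ?nnegrE // ler_nat.
rewrite -mulr_sumr ler_wpM2l //.
suff -> : \sum_(k < N) (2 ^+ k)^-1 = 2 - 2 / 2 ^+ N :> R[i].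
  by rewrite gerBl divr_ge0.
elim: N {hN} => [|N IH]; first by rewrite big_ord0 expr0 divr1 subrr.
rewrite big_ord_recr /= IH exprS; field.
by rewrite expf_neq0.
Qed.

(** The order of [R[i]] is partial; [C / e] is nonnegative, hence real, and the
    archimedean property of [R] applies. *)
Lemma near_geom (C e : R[i]) : 0 <= C -> 0 < e ->
  \forall n \near \oo, C / 2 ^+ n < e.
Proof.
move=> C0 e0.
have /complex_realP[k Ck] : C / e \is Num.real.
  by rewrite ger0_real // divr_ge0 // ltW.
near=> n; rewrite ltr_pdivrMr ?exprn_gt0 // mulrC -ltr_pdivrMr //.
apply: (@lt_le_trans _ _ n%:R); last first.
  by rewrite -natrX ler_nat ltnW // ltn_expl.
rewrite Ck (_ : n%:R = (n%:R : R)%:C); last by rewrite rmorph_nat.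
by rewrite ltcR; near: n; exact: nbhs_infty_gtr.
Unshelve. all: by end_near. Qed.

(** Coefficients of the product of two power series. *)
Definition cauchy_prod a b k := \sum_(i < k.+1) a i * b (k - i)%N.

Lemma coef_mul_trunc a b n k : (k < n)%N ->
  ((\poly_(i < n) a i) * (\poly_(i < n) b i))`_k = cauchy_prod a b k.
Proof.
move=> kn; rewrite coefM; apply: eq_bigr => i _.
have ik : (i < n)%N by apply: leq_trans (ltn_ord i) kn.
have kin : (k - i < n)%N by apply: leq_ltn_trans (leq_subr i k) kn.
by rewrite !coef_poly ik kin.
Qed.

(** The product of the partial sums of order [n] differs from the partial sum of
    the Cauchy product by terms of degree [k >= n], each bounded by
    [(k + 1) A B / 8 ^ k]; the total is at most [A B / 2 ^ n]. *)
Lemma pser_mul a b z0 la lb z l m :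
  pser a z0 la -> pser b z0 lb -> `|z| <= `|z0| / 8 ->
  pser a z l -> pser b z m -> pser (cauchy_prod a b) z (l * m).
Proof.
move=> /pser_coef_bound [A A0 hA] /pser_coef_bound [B B0 hB] hz za zb.
pose C n : R[i] := \sum_(k < n) cauchy_prod a b k * z ^+ k.
pose S (c : nat -> R[i]) n : R[i] := \sum_(k < n) c k * z ^+ k.
have key n : `|S a n * S b n - C n| <= A * B / 2 ^+ n.
  pose p : {poly R[i]} := \poly_(i < n) a i.
  pose q : {poly R[i]} := \poly_(i < n) b i.
  have -> : S a n * S b n = \sum_(k < n + n) (p * q)`_k * z ^+ k.
    rewrite -(@horner_coef_wide _ (n + n)) ?hornerM ?horner_poly //.
    apply: leq_trans (size_polyMleq _ _) _.
    by apply: leq_trans (leq_pred _) _; rewrite leq_add // size_poly.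
  rewrite big_split_ord /=.
  have -> : \sum_(i < n) (p * q)`_i * z ^+ i = C n.
    by apply: eq_bigr => i _; rewrite coef_mul_trunc.
  rewrite addrAC subrr add0r; apply: (le_trans (ler_norm_sum _ _ _)).
  have pterm i : `|p`_i * z ^+ i| <= A / 8 ^+ i.
    rewrite coef_poly; case: ifP => _; first exact: (pser_term_le (hA i)).
    by rewrite mul0r normr0 divr_ge0 // exprn_ge0.
  have qterm i : `|q`_i * z ^+ i| <= B / 8 ^+ i.
    rewrite coef_poly; case: ifP => _; first exact: (pser_term_le (hB i)).
    by rewrite mul0r normr0 divr_ge0 // exprn_ge0.
  apply: (@le_trans _ _ (\sum_(i < n) A * B / 4 ^+ n)).
    apply: ler_sum => i _; set k := (n + i)%N.
    have nk : (n <= k)%N by exact: leq_addr.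
    rewrite coefM mulr_suml; apply: (le_trans (ler_norm_sum _ _ _)).
    apply: (@le_trans _ _ (\sum_(j < k.+1) A * B / 8 ^+ k)).
      apply: ler_sum => j _.
      have jk : (j <= k)%N by rewrite -ltnS.
      have -> : p`_j * q`_(k - j) * z ^+ k =
         (p`_j * z ^+ j) * (q`_(k - j) * z ^+ (k - j)).
        by rewrite mulrACA -exprD subnKC.
      have -> : A * B / 8 ^+ k = (A / 8 ^+ j) * (B / 8 ^+ (k - j)).
        by rewrite mulrACA -invfM -exprD subnKC.
      by rewrite normrM ler_pM.
    rewrite sumr_const card_ord -[_ *+ _]mulr_natr -!mulrA.
    rewrite ler_wpM2l // ler_wpM2l //.
    have -> : (8 : R[i]) = 2 * 4 by rewrite -natrM.
    rewrite exprMn invfM mulrAC -[leRHS]mul1r; apply: ler_pM.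
    - by rewrite mulr_ge0 // invr_ge0 exprn_ge0.
    - by rewrite invr_ge0 exprn_ge0.
    - by rewrite mulrC ler_pdivrMr ?exprn_gt0 // mul1r -natrX ler_nat ltn_expl.
    rewrite lef_pV2 ?posrE ?exprn_gt0 //.
    by rewrite ler_eXn2l // ltr1n.
  rewrite sumr_const card_ord -[_ *+ _]mulr_natr -!mulrA ler_wpM2l // ler_wpM2l //.
  have -> : (4 : R[i]) = 2 * 2 by rewrite -natrM.
  rewrite exprMn invfM -mulrA ger_pMr ?invr_gt0 ?exprn_gt0 //.
  rewrite mulrC ler_pdivrMr ?exprn_gt0 // mul1r -natrX ler_nat.
  by rewrite ltnW // ltn_expl.
have zab : (fun n => S a n * S b n : R[i]^o) @ \oo --> (l * m : R[i]^o).
  apply: cvgM.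
    by rewrite (_ : S a = series (fun k => a k * z ^+ k)) // seriesEord.
  by rewrite (_ : S b = series (fun k => b k * z ^+ k)) // seriesEord.
apply/pserP => e e0; near=> n.
have -> : l * m - \sum_(k < n) cauchy_prod a b k * z ^+ k =
  (l * m - S a n * S b n) + (S a n * S b n - C n) by rewrite addrA subrK.
apply: (le_lt_trans (ler_normD _ _)); rewrite [e]splitr ltrD //.
  by near: n; move/cvgrPdist_lt: zab; apply; rewrite divr_gt0.
apply: (le_lt_trans (key n)).
by near: n; apply: near_geom; rewrite ?mulr_ge0 // divr_gt0.
Unshelve. all: by end_near. Qed.

End PowerSeries.

(** * Germs of holomorphic functions on the surface *)

Section Local.
Variables (R : realType) (M : compactRiemannSurface R).
Implicit Types (i j : chart_index M) (p q : M) (f g h : M -> R[i]).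
Local Notation coord := Defs.coord.

Lemma coord_neq0 i p q : dom i p -> dom i q -> q != p -> coord i p q != 0.
Proof.
move=> ip iq; apply: contraNneq => /subr0_eq e.
by apply/eqP; apply: chart_inj e.
Qed.

Lemma near_dom i p : dom i p -> \forall q \near p, dom i q.
Proof. by move=> ip; apply: open_nbhs_nbhs; split=> //; exact: open_dom. Qed.

Lemma near_coord_neq0 i p : dom i p -> \forall q \near p^', coord i p q != 0.
Proof.
move=> ip; near=> q; apply: coord_neq0 => //; last first.
  by near: q; exact: nbhs_dnbhs_neq.
by near: q; apply: nbhs_dnbhs; exact: near_dom.
Unshelve. all: by end_near. Qed.

Lemma near_coord_small i p (e : R[i]) : dom i p -> 0 < e ->
  \forall q \near p, `|coord i p q| < e.
Proof.
move=> ip e0; have := @chart_continuous _ M i.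
rewrite continuous_open_subspace; last exact: open_dom.
move=> /(_ p); rewrite inE => /(_ ip) /cvgrPdist_lt /(_ e e0).
by apply: filterS => q; rewrite distrC.
Qed.

(** The surface has no isolated point: charts are open maps to the plane. *)
Lemma dnbhs_nonempty p (S : set M) : (\forall q \near p^', S q) -> exists q, S q.
Proof.
rewrite near_withinE nbhsE => -[A [oA Ap] sAS].
pose i := chart_at p; have ip : dom i p by exact: chart_atP.
have oU : open (chart i @` (A `&` dom i)).
  by apply: chart_open => //; apply: openI => //; exact: open_dom.
have : (chart i p : R[i]^o)^' (chart i @` (A `&` dom i)).
  by apply: nbhs_dnbhs; apply: open_nbhs_nbhs; split=> //; exists p.
have n := @nbhs_dnbhs_neq _ (chart i p : R[i]^o).
move=> U; have pF : ProperFilter ((chart i p : R[i]^o)^').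
  exact: Proper_dnbhs_regular_numFieldType.
have [z [[q [Aq iq] <-] qp]] := @filter_ex _ _ pF _ (filterI U n).
by exists q; apply: sAS => //; apply: contraNneq qp => ->.
Qed.

Lemma holo_at_near i f h p : holo_at i f p ->
  (\forall q \near p, f q = h q) -> holo_at i h p.
Proof.
by move=> [c hc] e; exists c; move: hc e; apply: filterS2 => q ? <-.
Qed.

Lemma holo_cst i p (c : R[i]) : holo_at i (fun=> c) p.
Proof.
exists (fun k => if k is 0%N then c else 0); near=> q.
have := @pser_poly R (fun k => if k is 0%N then c else 0) 1 (coord i p q).
by rewrite big_ord1 expr0 mulr1; apply; case.
Unshelve. all: by end_near. Qed.

Lemma holo_coord i p : holo_at i (coord i p) p.
Proof.
exists (fun k => (k == 1%N)%:R); near=> q.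
have := @pser_poly R (fun k => (k == 1%N)%:R) 2 (coord i p q).
rewrite !big_ord_recl big_ord0 /= mul0r add0r addr0 expr1 mul1r.
by apply; case=> [|[]].
Unshelve. all: by end_near. Qed.

Lemma holoD i f g p : holo_at i f p -> holo_at i g p ->
  holo_at i (fun q => f q + g q) p.
Proof.
move=> [a ha] [b hb]; exists (fun k => a k + b k).
by move: ha hb; apply: filterS2 => q; exact: pserD.
Qed.

(** A point [q0 != p] at which the property [S] holds, chosen before a smaller
    disc around [p]: the reference point of the power series estimates. *)
Lemma near_disc i p (S : set M) : dom i p -> (\forall q \near p, S q) ->
  exists q0, [/\ S q0, coord i p q0 != 0 &
    \forall q \near p, `|coord i p q| <= `|coord i p q0| / 8].
Proof.
move=> ip pS; have [q0 [q0S q00]] :=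
   dnbhs_nonempty (filterI (nbhs_dnbhs pS) (near_coord_neq0 ip)).
exists q0; split=> //.
have /near_coord_small : 0 < `|coord i p q0| / 8 by rewrite divr_gt0 // normr_gt0.
by move=> /(_ i p ip); apply: filterS => q /ltW.
Qed.

Lemma holoM i f g p : dom i p -> holo_at i f p -> holo_at i g p ->
  holo_at i (fun q => f q * g q) p.
Proof.
move=> ip [a ha] [b hb]; exists (cauchy_prod a b).
have [q0 [[fq0 gq0] _ hq]] := near_disc ip (filterI ha hb).
move: hq ha hb; apply: filterS3 => q; exact: (pser_mul fq0 gq0).
Qed.

Lemma holo_bounded i f p : dom i p -> holo_at i f p ->
  exists B : R[i], \forall q \near p, `|f q| <= B.
Proof.
move=> ip [a ha]; have [q0 [fq0 _ hq]] := near_disc ip ha.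
have [B hB] := pser_bounded fq0; exists B.
by move: hq ha; apply: filterS2 => q; exact: hB.
Qed.

(** First-order Taylor formula with holomorphic quotient. *)
Lemma holo_factor i f p : dom i p -> holo_at i f p ->
  exists2 g, holo_at i g p & \forall q \near p, f q = f p + coord i p q * g q.
Proof.
move=> ip [c hc]; have cp0 : coord i p p = 0 by rewrite /coord subrr.
have fp : f p = c 0%N.
  have h : pser c (coord i p p) (f p) by exact: nbhs_singleton hc.
  by rewrite cp0 in h; exact: pser_unique h (@pser_at0 _ c).
(* At [p] itself the quotient takes the value of the shifted series. *)
exists (fun q => if q == p then c 1%N else (f q - f p) / coord i p q).
  exists (fun k => c k.+1); near=> q; case: eqVneq => [->|qp].
    by rewrite cp0; exact: (@pser_at0 _ (fun k => c k.+1)).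
  rewrite fp; apply: pser_shift; last by near: q; exact: hc.
  by apply: coord_neq0 => //; near: q; exact: near_dom.
near=> q; case: eqVneq => [->|qp]; first by rewrite cp0 mul0r addr0.
rewrite [RHS]addrC [coord _ _ _ * _]mulrC divfK ?subrK //.
by apply: coord_neq0 => //; near: q; exact: near_dom.
Unshelve. all: by end_near. Qed.

(** The value at [p] of a holomorphic germ is determined by its values near [p]. *)
Lemma holo_punctured0 i f p : dom i p -> holo_at i f p ->
  (\forall q \near p^', f q = 0) -> f p = 0.
Proof.
move=> ip hf f0; have [g hg fE] := holo_factor ip hf.
have [B gB] := holo_bounded ip hg.
apply/eqP; apply: contraT => fp0.
pose e := `|f p| / (`|B| + 1).
have e0 : 0 < e by rewrite divr_gt0 ?normr_gt0 // ltr_wpDl.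
have small := near_coord_small ip e0.
suff [q] : exists q, `|f p| < `|f p| by rewrite ltxx.
apply: (@dnbhs_nonempty p); near=> q.
have : f p = - (coord i p q * g q).
  apply/eqP; rewrite -addr_eq0; apply/eqP.
  transitivity (f q); last by near: q.
  by apply/esym; near: q; exact: nbhs_dnbhs.
move=> {1}->; rewrite normrN normrM.
apply: (@le_lt_trans _ _ (`|coord i p q| * (`|B| + 1))).
  rewrite ler_wpM2l //; apply: (@le_trans _ _ B).
    by near: q; exact: nbhs_dnbhs.
  apply: (@le_trans _ _ `|B|); last by rewrite lerDl.
  rewrite real_ler_norm // ger0_real //.
  apply: (@le_trans _ _ `|g q|) => //; near: q; exact: nbhs_dnbhs.
rewrite -ltr_pdivlMr ?ltr_wpDl //; near: q; exact: nbhs_dnbhs.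
Unshelve. all: by end_near. Qed.

End Local.

(** * Orders and leading Laurent coefficients *)

Section Orders.
Variables (R : realType) (M : compactRiemannSurface R).
Implicit Types (p q : M) (f g h : M -> R[i]) (n m : int) (c d : R[i]).
Local Notation coord := Defs.coord.

(** [f] is meromorphic at [p] with order at least [n], and [c] is the coefficient
    of the [n]-th power of the preferred local coordinate in its Laurent
    expansion; [c] may vanish. *)
Definition laurent_lead f p n c : Prop :=
  exists h, [/\ holo_at (chart_at p) h p, h p = c &
    \forall q \near p^', f q = coord (chart_at p) p q ^ n * h q].

Lemma ord_ge_lead f p n : ord_ge f p n <-> exists c, laurent_lead f p n c.
Proof.
split=> [[h [hh e]]|[c [h [hh _ e]]]]; last by exists h.
by exists (h p), h.
Qed.

Lemma ord_eq_lead f p n : ord_eq f p n -> exists2 c, c != 0 & laurent_lead f p n c.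
Proof. by move=> [h [hh hp e]]; exists (h p) => //; exists h. Qed.

Lemma laurent_lead_near f g p n c : (\forall q \near p^', f q = g q) ->
  laurent_lead f p n c -> laurent_lead g p n c.
Proof.
move=> fg [h [hh hp e]]; exists h; split=> //.
by move: fg e; apply: filterS2 => q <- ->.
Qed.

Lemma laurent_lead_cst p c : laurent_lead (fun=> c) p 0 c.
Proof.
exists (fun=> c); split=> //; first exact: holo_cst.
by near=> q; rewrite expr0z mul1r.
Unshelve. all: by end_near. Qed.

Lemma laurent_lead0 p n : laurent_lead (fun=> 0) p n 0.
Proof.
exists (fun=> 0); split=> //; first exact: holo_cst.
by near=> q; rewrite mulr0.
Unshelve. all: by end_near. Qed.

Lemma laurent_leadD f g p n c d : laurent_lead f p n c -> laurent_lead g p n d ->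
  laurent_lead (fun q => f q + g q) p n (c + d).
Proof.
move=> [h [hh hp he]] [k [kh kp ke]]; exists (fun q => h q + k q).
split; [exact: holoD | by rewrite hp kp |].
by move: he ke; apply: filterS2 => q -> ->; rewrite mulrDr.
Qed.

Lemma laurent_leadM f g p n m c d :
  laurent_lead f p n c -> laurent_lead g p m d ->
  laurent_lead (fun q => f q * g q) p (n + m) (c * d).
Proof.
move=> [h [hh hp he]] [k [kh kp ke]]; exists (fun q => h q * k q).
split; [by apply: holoM => //; exact: chart_atP | by rewrite hp kp |].
move: he ke (near_coord_neq0 (chart_atP p)).
by apply: filterS3 => q -> -> z0; rewrite expfzDr // mulrACA.
Qed.

Lemma laurent_leadX f p n c k : laurent_lead f p n c ->
  laurent_lead (fun q => f q ^+ k) p (n *+ k) (c ^+ k).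
Proof.
move=> hf; elim: k => [|k IH]; first exact: laurent_lead_cst.
rewrite mulrS exprS; move: (laurent_leadM hf IH); apply: laurent_lead_near.
by near=> q; rewrite exprS.
Unshelve. all: by end_near. Qed.

Lemma laurent_leadZ a f p n c : laurent_lead f p n c ->
  laurent_lead (fun q => a * f q) p n (a * c).
Proof. by move=> /(laurent_leadM (laurent_lead_cst p a)); rewrite add0r. Qed.

Lemma laurent_lead_sum (m : nat) (a : 'I_m -> R[i]) (f : 'I_m -> M -> R[i]) p n
    (c : 'I_m -> R[i]) :
  (forall j, laurent_lead (f j) p n (c j)) ->
  laurent_lead (fun q => \sum_(j < m) a j * f j q) p n (\sum_(j < m) a j * c j).
Proof.
elim: m a f c => [|m IH] a f c hf.
  rewrite big_ord0; move: (laurent_lead0 p n); apply: laurent_lead_near.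
  by near=> q; rewrite big_ord0.
rewrite big_ord_recr /=.
have h1 := IH (a \o widen_ord (leqnSn m)) (f \o widen_ord (leqnSn m)) _
  (fun j => hf (widen_ord (leqnSn m) j)).
move: (laurent_leadD h1 (laurent_leadZ (a ord_max) (hf ord_max))).
by apply: laurent_lead_near; near=> q; rewrite big_ord_recr.
Unshelve. all: by end_near. Qed.

Lemma laurent_lead_unique f p n c d :
  laurent_lead f p n c -> laurent_lead f p n d -> c = d.
Proof.
move=> [h [hh <- he]] [k [kh <- ke]]; apply/eqP; rewrite -subr_eq0; apply/eqP.
have ip := chart_atP p.
pose u q := h q + (-1) * k q.
suff : u p = 0 by rewrite /u mulN1r.
apply: (holo_punctured0 ip).
  exact: (holoD hh (holoM ip (holo_cst _ p (-1)) kh)).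
move: he ke (near_coord_neq0 ip); apply: filterS3 => q -> e z0.
have /mulfI : coord (chart_at p) p q ^ n != 0 by rewrite expfz_neq0.
by move=> /(_ _ _ e) hk; rewrite /u hk mulN1r subrr.
Qed.

(** If the coefficient of index [n] vanishes, the order is at least [n + 1]. *)
Lemma laurent_lead0_ord f p n : laurent_lead f p n 0 -> ord_ge f p (n + 1).
Proof.
move=> [h [hh hp he]]; have ip := chart_atP p.
have [k kh kE] := holo_factor ip hh; exists k; split=> //.
move: he (nbhs_dnbhs kE) (near_coord_neq0 ip); apply: filterS3 => q -> -> z0.
by rewrite hp add0r expfzDr // expr1z mulrA.
Qed.

Lemma ord_ge_lead0 f p n m : n < m -> ord_ge f p m -> laurent_lead f p n 0.
Proof.
move=> nm [h [hh he]]; have ip := chart_atP p.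
have [k mE] : exists k : nat, m = n + k.+1%:Z.
  exists `|m - n|.-1%N; rewrite prednK ?absz_gt0 ?subr_eq0 ?gt_eqF //.
  by rewrite gez0_abs ?subr_ge0 ?ltW // addrCA subrr addr0.
have hk : holo_at (chart_at p) (fun q => coord (chart_at p) p q ^+ k.+1 * h q) p.
  elim: k.+1 => [|l IH].
    by apply: holo_at_near hh _; near=> q; rewrite expr0 mul1r.
  apply: holo_at_near (holoM ip (holo_coord _ p) IH) _.
  by near=> q; rewrite exprS mulrA.
eexists; split; [exact: hk | by rewrite /coord subrr expr0n mul0r |].
move: he (near_coord_neq0 ip); apply: filterS2 => q -> z0.
by rewrite mE expfzDr // mulrA.
Unshelve. all: by end_near. Qed.

Lemma ord_ge_le f p n m : n <= m -> ord_ge f p m -> ord_ge f p n.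
Proof.
rewrite le_eqVlt => /predU1P[->//|nm] hf.
by apply/ord_ge_lead; exists 0; exact: ord_ge_lead0 hf.
Qed.

End Orders.

(** * Divisors of consecutive degrees *)

Section Divisors.
Variables (R : realType) (M : compactRiemannSurface R).
Implicit Types D E : divisor M.

Lemma div_deg_finite D (S : set M) : finite_set S -> [set p | D p != 0] `<=` S ->
  div_deg D = \sum_(p <- fset_set S) D p.
Proof.
move=> fS DS; rewrite /div_deg (@fsbigTE _ _ _ _ (fset_set S)) // => p.
by rewrite in_fset_set // => pS; apply/eqP; apply: contraNT pS => /DS; rewrite inE.
Qed.

(** If [D <= E] and the degrees differ by one, then [E] is [D] plus a point. *)
Lemma div_le_deg1 D E : positive_divisor D -> positive_divisor E -> div_le D E ->
  div_deg E = div_deg D + 1 ->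
  exists p0, E p0 = D p0 + 1 /\ forall p, p != p0 -> E p = D p.
Proof.
move=> [fD D0] [fE E0] DE; pose S := [set p | D p != 0] `|` [set p | E p != 0].
have fS : finite_set S by rewrite finite_setU.
rewrite (@div_deg_finite D S) //; last by move=> p; left.
rewrite (@div_deg_finite E S) //; last by move=> p; right.
move=> /eqP; rewrite -subr_eq0 opprD addrA -sumrB subr_eq0 => /eqP degE.
have F0 p : 0 <= E p - D p by rewrite subr_ge0.
have outS p : p \notin fset_set S -> E p = D p.
  rewrite in_fset_set // => pS.
  have [/eqP-> /eqP->//] : E p == 0 /\ D p == 0.
  by split; apply: contraNT pS => h; rewrite inE; [right | left].
have [p0 p0S Fp0] : exists2 p, p \in fset_set S & E p - D p != 0.
  apply/hasP; apply: contraT => /hasPn nF.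
  suff : (1 : int) = 0 by [].
  by rewrite -degE big_seq big1 // => p /nF /negbNE/eqP.
have Fp0_ge1 : 1 <= E p0 - D p0 by rewrite -gtz0_ge1 lt_def Fp0 F0.
move: degE; rewrite (bigD1_seq p0) //=; set rest := \sum_(p <- _ | _) _ => degE.
have rest_ge0 : 0 <= rest by exact: sumr_ge0.
have restE : rest = 0.
  apply/eqP; rewrite eq_le rest_ge0 andbT -(lerD2l (E p0 - D p0)) degE addr0.
  exact: Fp0_ge1.
have Ep0 : E p0 = D p0 + 1 by rewrite -degE restE addr0 addrC subrK.
exists p0; split=> //.
move=> p pp0; case: (boolP (p \in fset_set S)) => [pS|]; last exact: outS.
move/eqP: restE; rewrite psumr_eq0 // => /allP /(_ p pS); rewrite pp0 /= subr_eq0.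
by move/eqP.
Qed.

End Divisors.

(** * Sections and linear dependence *)

Section Sections.
Variables (R : realType) (M : compactRiemannSurface R) (L : cocycle M).
Implicit Types (phi psi : section M) (D E : divisor M).

(** Linear combination of a finite family of sections. *)
Definition lincomb m (a : 'I_m -> R[i]) (v : 'I_m -> section M) : section M :=
  fun i q => \sum_(j < m) a j * v j i q.

Lemma section_eq_sym phi psi : section_eq phi psi -> section_eq psi phi.
Proof. by move=> h i p ip; move: (h i p ip); apply: filterS. Qed.

Lemma section_eq_lincomb m (a : 'I_m -> R[i]) (v w : 'I_m -> section M) :
  (forall j, section_eq (v j) (w j)) ->
  section_eq (lincomb a v) (lincomb a w).
Proof.
move=> vw i p ip.
have : \forall q \near p^', forall j, v j i q = w j i q.
  by apply: filter_forall => j; exact: vw.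
by apply: filterS => q e; apply: eq_bigr => j _; rewrite e.
Qed.

Lemma H0_ext D phi psi : section_eq phi psi -> H0 L D phi -> H0 L D psi.
Proof.
move=> e [h1 h2]; split=> [i j p ip jp|p].
  move: (h1 i j p ip jp) (e i p ip) (e j p jp).
  by apply: filterS3 => q + <- <-.
have /ord_ge_lead[c hc] := h2 p; apply/ord_ge_lead; exists c.
by move: hc; apply: laurent_lead_near; apply: e; exact: chart_atP.
Qed.

Lemma H0_le D E phi : div_le D E -> H0 L D phi -> H0 L E phi.
Proof.
by move=> DE [h1 h2]; split=> // p; apply: ord_ge_le (h2 p); rewrite lerN2.
Qed.

Lemma H0_lincomb m D (a : 'I_m -> R[i]) (v : 'I_m -> section M) :
  (forall j, H0 L D (v j)) -> H0 L D (lincomb a v).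
Proof.
move=> hv; split=> [i k p ip kp|p].
  have : \forall q \near p^', forall j, v j i q = L i k q * v j k q.
    by apply: filter_forall => j; exact: (hv j).1.
  apply: filterS => q e; rewrite /lincomb mulr_sumr; apply: eq_bigr => j _.
  by rewrite e mulrCA.
have /choice[c hc] : forall j, exists c, laurent_lead (v j (chart_at p)) p (- D p) c.
  by move=> j; apply/ord_ge_lead; exact: (hv j).2.
by apply/ord_ge_lead; eexists; exact: laurent_lead_sum hc.
Qed.

Lemma H0_lin2 D a b phi psi : H0 L D phi -> H0 L D psi ->
  H0 L D (fun i q => a * phi i q + b * psi i q).
Proof.
move=> hphi hpsi.
have := @H0_lincomb 2 D (fun j => if j == ord0 then a else b)
   (fun j => if j == ord0 then phi else psi).
set s := lincomb _ _; suff -> : s = fun i q => a * phi i q + b * psi i q.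
  by apply=> j; case: eqP.
apply/funext => i; apply/funext => q.
by rewrite /s /lincomb !big_ord_recl big_ord0 /= addr0.
Qed.

(** Allowing one more pole [p0] raises the dimension by at most one: a combination
    of sections in [H0 L E] lies in [H0 L D] as soon as its Laurent coefficient of
    index [- E p0] at [p0] vanishes, which is one linear condition. *)
Lemma H0_codim1 m D E p0 (v : 'I_m -> section M) :
  E p0 = D p0 + 1 -> (forall p, p != p0 -> E p = D p) ->
  (forall j, H0 L E (v j)) ->
  exists c : 'I_m -> R[i], forall a : 'I_m -> R[i],
    \sum_(j < m) a j * c j = 0 -> H0 L D (lincomb a v).
Proof.
move=> Ep0 Ep hv.
have /choice[c hc] : forall j, exists c,
    laurent_lead (v j (chart_at p0)) p0 (- E p0) c.
  by move=> j; apply/ord_ge_lead; exact: (hv j).2.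
exists c => a ac; have [h1 h2] := H0_lincomb a hv; split=> // p.
have [->|/Ep <-//] := eqVneq p p0.
have := laurent_lead_sum a hc; rewrite ac => /laurent_lead0_ord.
by rewrite Ep0 opprD subrK.
Qed.

(** Dimension count along [s] steps of a chain of divisors: among the combinations
    of [m] sections, those in the smaller space form a subspace of dimension at
    least [m - s]. *)
Lemma H0_chain (D : nat -> divisor M) n s m (v : 'I_m -> section M) :
  (forall k, exists p0, D k.+1 p0 = D k p0 + 1 /\
                        forall p, p != p0 -> D k.+1 p = D k p) ->
  (forall j, H0 L (D (n + s)%N) (v j)) ->
  exists U : 'M[R[i]]_m, (m - s <= \rank U)%N /\
    forall a : 'rV_m, (a <= U)%MS -> H0 L (D n) (lincomb (a ord0) v).
Proof.
move=> step; elim: s v => [|s IH] v hv.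
  exists 1%:M; rewrite mxrank1 subn0; split=> // a _.
  by rewrite addn0 in hv; exact: H0_lincomb.
have [p0 [Ep0 Ep]] := step (n + s)%N.
rewrite addnS in hv; have [c hc] := H0_codim1 Ep0 Ep hv.
pose C : 'cV_m := \col_j c j; pose K := kermx C.
pose w j := lincomb (K j) v.
have /IH[U [rU hU]] : forall j, H0 L (D (n + s)%N) (w j).
  move=> j; apply: hc; transitivity ((K *m C) j ord0).
    by rewrite [RHS]mxE; apply: eq_bigr => k _; rewrite [C k _]mxE.
  by rewrite mulmx_ker mxE.
exists (U *m K); split.
  apply: leq_trans (mxrank_mul_min _ _); rewrite mxrank_ker.
  have := rank_leq_col C; lia.
move=> a /submxP[b ->]; have := hU (b *m U) (submxMl _ _).
congr (H0 L (D n) _); apply/funext => i; apply/funext => q.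
rewrite /lincomb /w mulmxA.
under eq_bigr do rewrite /lincomb mulr_sumr.
rewrite exchange_big; apply: eq_bigr => j _ /=.
by rewrite [in RHS]mxE mulr_suml; apply: eq_bigr => k _; rewrite mulrA.
Qed.

Lemma H0_dependent (D : nat -> divisor M) n s m (v : 'I_m -> section M) :
  (forall k, exists p0, D k.+1 p0 = D k p0 + 1 /\
                        forall p, p != p0 -> D k.+1 p = D k p) ->
  (forall j, H0 L (D (n + s)%N) (v j)) -> (s < m)%N ->
  exists2 a : 'I_m -> R[i], (exists j, a j != 0) & H0 L (D n) (lincomb a v).
Proof.
move=> step hv sm; have [U [rU hU]] := H0_chain step hv.
have U0 : U != 0 by rewrite -mxrank_eq0; lia.
exists (nz_row U ord0); last by apply: hU; exact: nz_row_sub.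
by apply/rV0Pn; rewrite nz_row_eq0.
Qed.

End Sections.

(** * Multiplication by the meromorphic function *)

Section MulZ.
Variables (R : realType) (M : compactRiemannSurface R) (L : cocycle M).
Variables (Z : M -> R[i]) (Xi : divisor M).
Hypothesis polarZ : polar_divisor Z Xi.
Implicit Types (phi psi : section M) (E : divisor M).

(** Product of a section by the polynomial [f] in the function [Z]. *)
Definition mulZ (f : {poly R[i]}) phi : section M := fun i q => f.[Z q] * phi i q.

(** Combination of sections with coefficients that are polynomials in [Z]. *)
Definition polycomb r (f : 'I_r -> {poly R[i]}) (b : 'I_r -> section M) :
  section M := fun i q => \sum_(j < r) (f j).[Z q] * b j i q.

(** The divisor [m Xi]. *)
Definition multiple_div m : divisor M := fun p => Xi p *+ m.

Lemma le_multiple_div m n : (m <= n)%N -> div_le (multiple_div m) (multiple_div n).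
Proof. by move=> mn p; rewrite /multiple_div ler_wpMn2l // polarZ.1.2. Qed.

Lemma H0_mulXn k E phi : H0 L E phi ->
  H0 L (fun p => E p + Xi p *+ k) (mulZ 'X^k phi).
Proof.
move=> [h1 h2]; split=> [i j p ip jp|p].
  move: (h1 i j p ip jp); apply: filterS => q.
  by rewrite /mulZ => ->; rewrite mulrCA.
have [c hc] := (ord_ge_lead _ _ _).1 (h2 p).
have [d hd] := (ord_ge_lead _ _ _).1 (polarZ.2 p).1.
apply/ord_ge_lead; eexists.
rewrite opprD addrC -mulNrn.
move: (laurent_leadM (laurent_leadX k hd) hc); apply: laurent_lead_near.
by apply: nearW => q; rewrite /mulZ hornerXn.
Qed.

(** If [phi] has poles at most [Xi] and [Z ^ k phi] has poles at most [k Xi], then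
    [phi] is holomorphic: at a pole of [Z] the factor [Z ^ k] has order exactly
    [- k Xi], which leaves no room for a pole of [phi]. *)
Lemma H0_mulXn_holo k phi : H0 L Xi phi ->
  H0 L (multiple_div k) (mulZ 'X^k phi) -> H0 L (fun=> 0) phi.
Proof.
move=> [h1 h2] [_ k2]; split=> // p; rewrite oppr0.
have Xp0 : 0 <= Xi p by exact: polarZ.1.2.
have [/eqP Xp|Xp] := boolP (Xi p == 0).
  by have := h2 p; rewrite Xp oppr0.
have {}Xp : 0 < Xi p by rewrite lt_def Xp.
have /ord_eq_lead[u u0 hu] := (polarZ.2 p).2 Xp.
(* The order of [phi] at [p] is raised from [- Xi p] to 0, one unit at a time. *)
suff H (t : nat) : t%:Z <= Xi p -> ord_ge (phi (chart_at p)) p (- Xi p + t%:Z).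
  by have := H `|Xi p|%N; rewrite gez0_abs // addNr; apply.
elim: t => [|t IH] tX; first by rewrite addr0.
have /IH /ord_ge_lead[c hc] : t%:Z <= Xi p by apply: le_trans tX; rewrite lez_nat.
rewrite -addn1 PoszD addrA; apply: laurent_lead0_ord.
suff c0 : c = 0 by rewrite -[0]c0.
have lt_ord : - Xi p *+ k + (- Xi p + t%:Z) < - multiple_div k p.
  rewrite /multiple_div mulNrn gtrDl -(ltrD2l (Xi p)) addr0 addNKr.
  by apply: lt_le_trans tX; rewrite ltz_nat.
have lc0 := ord_ge_lead0 lt_ord (k2 p).
have lcu : laurent_lead (mulZ 'X^k phi (chart_at p)) p
    (- Xi p *+ k + (- Xi p + t%:Z)) (u ^+ k * c).
  move: (laurent_leadM (laurent_leadX k hu) hc); apply: laurent_lead_near.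
  by apply: nearW => q; rewrite /mulZ hornerXn.
have /eqP := laurent_lead_unique lcu lc0.
by rewrite mulf_eq0 expf_eq0 (negbTE u0) andbF /= => /eqP.
Qed.

Lemma H0_polycomb r (b : 'I_r -> section M) (f : 'I_r -> {poly R[i]}) m :
  (forall j, H0 L Xi (b j)) -> (forall j, size (f j) <= m)%N ->
  H0 L (multiple_div m) (polycomb f b).
Proof.
move=> hb fm.
have -> : polycomb f b = lincomb (fun=> 1)
    (fun j => lincomb (fun k : 'I_m => (f j)`_k) (fun k => mulZ 'X^k (b j))).
  apply/funext => i; apply/funext => q; apply: eq_bigr => j _.
  rewrite mul1r (horner_coef_wide _ (fm j)) mulr_suml.
  by apply: eq_bigr => k _; rewrite /mulZ hornerXn mulrA.
apply: H0_lincomb => j; apply: H0_lincomb => k.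
apply: (H0_le _ (H0_mulXn k (hb j))) => p.
rewrite -mulrS /multiple_div ler_wpMn2l //.
exact: polarZ.1.2.
Qed.

Hypothesis noholo : no_holo_section L.
Variables (r : nat) (b : 'I_r -> section M).
Hypothesis basisb : is_basis (H0 L Xi) b.

Lemma lincomb_eq0 (c : 'I_r -> R[i]) k :
  H0 L (multiple_div k) (mulZ 'X^k (lincomb c b)) -> forall j, c j = 0.
Proof.
have [bV bfree _] := basisb => h; apply: bfree.
by apply: noholo; apply: H0_mulXn_holo h; exact: H0_lincomb.
Qed.

(** Converse of [H0_polycomb]: poles bounded by [m Xi] force every coefficient to
    have degree less than [m].  For [m = 0] this says that the expansion on a basis
    is unique. *)
Lemma polycomb_size (f : 'I_r -> {poly R[i]}) m :
  H0 L (multiple_div m) (polycomb f b) -> forall j, (size (f j) <= m)%N.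
Proof.
have [bV _ _] := basisb => fm.
suff H d : (forall j, size (f j) <= m + d)%N -> forall j, (size (f j) <= m)%N.
  apply: (H (\max_j size (f j))%N) => j.
  by apply: leq_trans (leq_addl _ _); exact: (leq_bigmax j).
elim: d => [|d IH] fd j; first by rewrite -[m]addn0.
apply: IH => {}j; set N := (m + d)%N.
suff cj0 : (f j)`_N = 0.
  apply/leq_sizeP => k; rewrite leq_eqVlt => /predU1P[<-//|Nk].
  by apply: (leq_sizeP _ _ (fd j)); rewrite addnS.
move: j; apply: (@lincomb_eq0 (fun j => (f j)`_N) N).
(* Removing the terms of degree less than [N] leaves [Z ^ N] times the
   combination of the basis with coefficients [(f j)`_N]. *)
pose g j := take_poly N (f j).
have -> : mulZ 'X^N (lincomb (fun j => (f j)`_N) b) =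
    fun i q => 1 * polycomb f b i q + (-1) * polycomb g b i q.
  apply/funext => i; apply/funext => q.
  rewrite mul1r mulN1r -sumrB /mulZ /lincomb mulr_sumr.
  apply: eq_bigr => j _; rewrite mulrA -mulrBl; congr (_ * _).
  have fE : f j = take_poly N (f j) + (f j)`_N *: 'X^N.
    apply/polyP => k; rewrite coefD coefZ coefXn coef_take_poly.
    case: ltngtP => [||->]; rewrite ?mulr0 ?addr0 ?mulr1 ?add0r // => Nk.
    by apply: (leq_sizeP _ _ (fd j)); rewrite addnS.
  by rewrite {2}fE hornerD hornerZ addrC addKr mulrC.
apply: H0_lin2; first exact: H0_le (le_multiple_div (leq_addr d m)) fm.
by apply: H0_polycomb => // j; exact: size_take_poly.
Qed.

End MulZ.

(** * Expansions with polynomial coefficients *)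

Section Expansion.
Variables (R : realType) (M : compactRiemannSurface R) (L : cocycle M).
Variables (Z : M -> R[i]) (Xi : divisor M).
Hypothesis polarZ : polar_divisor Z Xi.
Hypothesis noholo : no_holo_section L.
Variables (r : nat) (D : nat -> divisor M).
Hypothesis D_step : forall k, exists p0, D k.+1 p0 = D k p0 + 1 /\
  forall p, p != p0 -> D k.+1 p = D k p.
Hypothesis D_multiple : forall k, D (k * r)%N = multiple_div Xi k.

(** Existence of the expansion.  Between [m Xi] and [(m + 1) Xi] there are [r]
    steps, so [phi] and the [r] sections [Z ^ m b_k] admit a nontrivial combination
    with poles at most [m Xi]; by [lincomb_eq0] it must involve [phi]. *)
Lemma polycomb_expansion (b : 'I_r -> section M) m phi :
  is_basis (H0 L Xi) b -> H0 L (D (m * r)%N) phi ->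
  exists2 f : 'I_r -> {poly R[i]}, (forall j, size (f j) <= m)%N &
    section_eq phi (polycomb Z f b).
Proof.
move=> basisb; have [bV _ _] := basisb.
elim: m phi => [|m IH] phi hphi.
  exists (fun=> 0) => [j|]; first by rewrite size_poly0.
  have : section_eq phi (@section0 R M).
    by apply: noholo; rewrite D_multiple in hphi.
  by congr section_eq; apply/funext => i; apply/funext => q;
     rewrite /polycomb big1 // => j _; rewrite horner0 mul0r.
pose v (j : 'I_r.+1) : section M :=
  if unlift ord0 j is Some k then mulZ Z 'X^m (b k) else phi.
have hv j : H0 L (D (m * r + r)%N) (v j).
  rewrite addnC -mulSn /v; case: unliftP => [k _|_] //.
  rewrite D_multiple; apply: H0_le (H0_mulXn polarZ m (bV k)) => p.
  by rewrite /multiple_div mulrS.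
have [a [j0 aj0] ha] := H0_dependent D_step hv (ltnSn r).
pose c k := a (lift ord0 k).
have vE : lincomb a v =
    fun i q => a ord0 * phi i q + mulZ Z 'X^m (lincomb c b) i q.
  apply/funext => i; apply/funext => q.
  rewrite /lincomb big_ord_recl {1}/v unlift_none; congr (_ + _).
  rewrite /mulZ mulr_sumr; apply: eq_bigr => k _.
  by rewrite /v liftK /mulZ mulrCA.
have a0 : a ord0 != 0.
  apply/eqP => a00; case/negP: aj0; apply/eqP.
  suff c0 k : c k = 0.
    by have [k ->|->] := unliftP ord0 j0; [exact: c0 | exact: a00].
  apply: (lincomb_eq0 polarZ noholo basisb (k := m)).
  rewrite -D_multiple; move: ha; congr (H0 L _ _); rewrite vE.
  by apply/funext => i; apply/funext => q; rewrite a00 mul0r add0r.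
have [f fm fE] := IH _ ha.
exists (fun k => (a ord0)^-1 *: (f k - c k *: 'X^m)) => [k|].
  apply: leq_trans (size_scale_leq _ _) _.
  apply: leq_trans (size_polyD _ _) _; rewrite geq_max size_polyN.
  rewrite (leq_trans (fm k)) //=.
  by apply: leq_trans (size_scale_leq _ _) _; rewrite size_polyXn.
move=> i p ip; move: (fE i p ip); apply: filterS => q; rewrite vE.
move=> /(canRL (addrK _)) /(canRL (mulKf a0)) ->.
rewrite /polycomb /mulZ /lincomb mulr_sumr -sumrB mulr_sumr.
apply: eq_bigr => k _.
by rewrite !(hornerZ, hornerD, hornerN) -mulrA mulrBl mulrCA mulrA.
Qed.

Section Generators.
Variable psi : nat -> section M.
Hypothesis psiP : forall l, spans_modulo (H0 L (D l.+1)) (H0 L (D l)) (psi l).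

Lemma D_le m n : (m <= n)%N -> div_le (D m) (D n).
Proof.
elim: n => [|n IH]; first by rewrite leqn0 => /eqP ->.
rewrite leq_eqVlt => /predU1P[->//|/IH mn] p; apply: le_trans (mn p) _.
have [p0 [E1 E2]] := D_step n.
by have [->|/E2->//] := eqVneq p p0; rewrite E1 lerDl.
Qed.

(** Consecutive generators starting from [psi k] are independent modulo
    [H0 L (D k)]. *)
Lemma generators_free k s (c : 'I_s -> R[i]) :
  H0 L (D k) (lincomb c (fun j => psi (k + j)%N)) -> forall j, c j = 0.
Proof.
elim: s c => [|s IH] c hc j; first by case: j.
pose c' (j : 'I_s) := c (widen_ord (leqnSn s) j).
have cE : lincomb c (fun j => psi (k + j)%N) =
  fun i q => lincomb c' (fun j => psi (k + j)%N) i q +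
             c ord_max * psi (k + s)%N i q.
  by apply/funext => i; apply/funext => q; rewrite /lincomb big_ord_recr.
have c's : H0 L (D (k + s)%N) (lincomb c' (fun j => psi (k + j)%N)).
  apply: H0_lincomb => i; have [h _ _] := psiP (k + i)%N.
  by apply: H0_le h; apply: D_le; rewrite ltn_add2l.
have cmax : c ord_max = 0.
  apply/eqP; apply: contraT => c0; have [_ + _] := psiP (k + s)%N; case.
  have := H0_lin2 (c ord_max)^-1 (- (c ord_max)^-1)
    (H0_le (D_le (leq_addr s k)) hc) c's.
  congr (H0 L _ _); rewrite cE; apply/funext => i; apply/funext => q.
  by rewrite mulNr -mulrBr addrC addKr mulKf.
have c'0 : forall j, c' j = 0.
  apply: IH; move: hc; congr (H0 L _ _); rewrite cE cmax.
  by apply/funext => i; apply/funext => q; rewrite mul0r addr0.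
have [i ->|->//] := unliftP ord_max j.
by rewrite -(c'0 i) /c'; congr c; apply/val_inj; rewrite /= /bump leqNgt ltn_ord.
Qed.

Lemma generators_span s phi : H0 L (D s) phi ->
  exists c : 'I_s -> R[i], section_eq phi (lincomb c (fun j => psi j)).
Proof.
elim: s phi => [|s IH] phi hphi.
  exists (fun=> 0); have : section_eq phi (@section0 R M).
    have := D_multiple 0; rewrite mul0n => D0.
    by apply: noholo; rewrite D0 in hphi.
  congr section_eq; apply/funext => i; apply/funext => q.
  by rewrite /lincomb big_ord0.
have [_ _ /(_ _ hphi)[a /IH[c hc]]] := psiP s.
exists (fun j => if unlift ord_max j is Some k then c k else a).
move=> i p ip; move: (hc i p ip); apply: filterS => q /(canRL (subrK _)) ->.
rewrite /lincomb big_ord_recr /= unlift_none; congr (_ + _).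
apply: eq_bigr => j _; have -> : widen_ord (leqnSn s) j = lift ord_max j.
  by apply/val_inj; rewrite /= /bump leqNgt ltn_ord.
by rewrite liftK.
Qed.

Lemma generators_basis : is_basis (H0 L Xi) (fun j : 'I_r => psi j).
Proof.
have DXi : D r = Xi by have := D_multiple 1; rewrite mul1n.
have D0 : D 0 = fun=> 0 by have := D_multiple 0; rewrite mul0n.
rewrite -DXi; split=> [j|c c0|phi]; last exact: generators_span.
  by have [h _ _] := psiP j; apply: H0_le h; exact: D_le.
apply: (@generators_free 0); apply: H0_ext (section_eq_sym c0) _.
rewrite D0; split=> [i j p _ _|p]; first by apply: nearW => q; rewrite mulr0.
by apply/ord_ge_lead; exists 0; exact: laurent_lead0.
Qed.

Lemma expansion_size k (F : 'M[{poly R[i]}]_r) :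
  (forall a : 'I_r,
     section_eq (psi (k * r + a)%N) (polycomb Z (F a) (fun j => psi j))) ->
  forall a j, (size (F a j) <= k.+1)%N.
Proof.
move=> FE a; apply: (polycomb_size polarZ noholo generators_basis).
apply: H0_ext (FE a) _; rewrite -D_multiple.
have [h _ _] := psiP (k * r + a)%N; apply: H0_le h; apply: D_le.
by rewrite mulSn [(r + _)%N]addnC -addnS leq_add2l.
Qed.

(** A row vector killed by the leading coefficient matrix gives a combination of
    [psi (k r), ..., psi (k r + r - 1)] whose expansion has degree less than [k],
    hence lies in [H0 L (k Xi)]; by [generators_free] the vector is zero. *)
Lemma expansion_lead_unit k (F : 'M[{poly R[i]}]_r) :
  (forall a : 'I_r,
     section_eq (psi (k * r + a)%N) (polycomb Z (F a) (fun j => psi j))) ->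
  \matrix_(a < r, j < r) (F a j)`_k \in unitmx.
Proof.
move=> FE; have Fk := expansion_size FE.
rewrite -row_free_unit; apply: inj_row_free => u uF.
suff u0 : forall a, u ord0 a = 0 by apply/rowP => a; rewrite u0 mxE.
apply: (@generators_free (k * r)); rewrite D_multiple.
apply: H0_ext (section_eq_sym (section_eq_lincomb _ FE)) _.
pose g j := \sum_a u ord0 a *: F a j.
have -> : lincomb (u ord0) (fun a => polycomb Z (F a) (fun j => psi j)) =
    polycomb Z g (fun j : 'I_r => psi j).
  apply/funext => i; apply/funext => q; rewrite /lincomb /polycomb.
  under eq_bigr do rewrite mulr_sumr.
  rewrite exchange_big; apply: eq_bigr => j _ /=.
  rewrite /g horner_sum mulr_suml; apply: eq_bigr => a _.
  by rewrite hornerZ mulrA.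
apply: H0_polycomb => // [j|j]; first by have [] := generators_basis.
apply/leq_sizeP => l; rewrite coef_sum leq_eqVlt => /predU1P[<-|kl].
  transitivity ((u *m \matrix_(a < r, j < r) (F a j)`_k) ord0 j).
    by rewrite [RHS]mxE; apply: eq_bigr => a _; rewrite coefZ [in RHS]mxE.
  by rewrite uF mxE.
rewrite big1 // => a _; rewrite coefZ (leq_sizeP _ _ (Fk a j)) // mulr0 //.
Qed.

Lemma expansion_degree k (F : 'M[{poly R[i]}]_r) : (0 < r)%N ->
  (forall a : 'I_r,
     section_eq (psi (k * r + a)%N) (polycomb Z (F a) (fun j => psi j))) ->
  poly_mx_degree k F.
Proof.
move=> r0 FE; have Fk := expansion_size FE.
apply/eqP; rewrite eqn_leq; apply/andP; split.
  by apply/bigmax_leqP => a _; apply/bigmax_leqP => j _.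
have : \matrix_(a < r, j < r) (F a j)`_k != 0.
  by rewrite -mxrank_eq0 (mxrank_unit (expansion_lead_unit FE)) -lt0n.
move=> /matrix0Pn[a [j]]; rewrite mxE => Fajk.
apply: leq_trans (leq_bigmax a); apply: leq_trans (leq_bigmax j).
by rewrite ltnNge; apply: contraNN Fajk => /leq_sizeP ->.
Qed.

End Generators.
End Expansion.

(** * The expansion theorem *)

Theorem proposition3p2 (R : realType) (M : compactRiemannSurface R)
  (sqrtK : cocycle M) (hsqrtK : line_bundle sqrtK)
  (sqrtK2 : bundle_iso (tensor sqrtK sqrtK) (canonical_bundle M))
  (h0sqrtK : no_holo_section sqrtK)
  (x0 : M) (chi : (R -> M) -> R[i]) (hchi : unitary_character x0 chi)
  (X : cocycle M) (hX : line_bundle X) (hXchi : flat_bundle_of x0 chi X)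
  (h0X : no_holo_section (tensor X sqrtK))
  (Z : M -> R[i]) (Xi : divisor M) (hXi : polar_divisor Z Xi)
  (r : nat) (r_gt0 : (0 < r)%N) (degXi : div_deg Xi = r%:Z)
  (Rl : nat -> divisor M)
  (Rl0 : Rl 0%N = fun=> 0)
  (hRl : forall l, (l < r)%N ->
     [/\ positive_divisor (Rl l), div_deg (Rl l) = l%:Z & div_le (Rl l) Xi])
  (D : nat -> divisor M)
  (hD : forall n, positive_divisor (D n) /\ div_deg (D n) = n%:Z)
  (D_incr : forall m n, (m < n)%N -> div_le (D m) (D n) /\ D m <> D n)
  (D_form : forall k l, (l < r)%N ->
     D (k * r + l)%N = fun p => Xi p *+ k + Rl l p) :
  let L := tensor X sqrtK in
  (* [P n] is P_{n-1}; in particular [P 0] is H^0(L) = {0} = P_{-1} *)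
  let P n := H0 L (D n) in
  (forall (n : nat) (phi : section M) (b : 'I_r -> section M),
     (r <= n)%N -> P n.+1 phi -> ~ P r phi -> is_basis (H0 L Xi) b ->
     exists f : 'I_r -> {poly R[i]},
       [/\ section_eq phi (fun i q => \sum_(j < r) (f j).[Z q] * b j i q),
           forall j, (size (f j) <= (n %/ r).+1)%N &
           ~ P (n %/ r * r)%N phi -> exists j, size (f j) = (n %/ r).+1])
  /\
  (forall psi : nat -> section M,
     (forall l, spans_modulo (P l.+1) (P l) (psi l)) ->
     is_basis (H0 L Xi) (fun j : 'I_r => psi j) /\
     forall k : nat,
       let expansion (F : 'M[{poly R[i]}]_r) :=
         forall a : 'I_r, section_eq (psi (k * r + a)%N)
           (fun i q => \sum_(j < r) (F a j).[Z q] * psi j i q) in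
       (exists F, expansion F) /\
       (forall F, expansion F -> poly_mx_degree k F /\
          \matrix_(a < r, j < r) (F a j)`_k \in unitmx)).
Proof.
move=> L P.
have D_multiple k : D (k * r)%N = multiple_div Xi k.
  by rewrite -[(k * r)%N]addn0 D_form // Rl0; apply/funext => p; rewrite addr0.
have D_step k : exists p0, D k.+1 p0 = D k p0 + 1 /\
    forall p, p != p0 -> D k.+1 p = D k p.
  have [[pos degk] [pos' degk']] := (hD k, hD k.+1).
  apply: div_le_deg1 => //; first exact: (D_incr _ _ (ltnSn k)).1.
  by rewrite degk degk' -addn1 PoszD.
split=> [n phi b _ hphi _ basisb | psi psiP].
  have [f fn phiE] : exists2 f : 'I_r -> {poly R[i]},
      (forall j, size (f j) <= (n %/ r).+1)%N & section_eq phi (polycomb Z f b).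
    apply: (polycomb_expansion hXi h0X D_step D_multiple basisb).
    by apply: H0_le hphi; apply: (D_le D_step); exact: ltn_ceil.
  exists f; split=> // nphi; apply: contrapT => nf; apply: nphi.
  rewrite /P D_multiple; apply: H0_ext (section_eq_sym phiE) _.
  apply: H0_polycomb => // [j|j]; first by have [] := basisb.
  rewrite -ltnS ltn_neqAle fn andbT; apply/negP => /eqP fj.
  by apply: nf; exists j.
have basispsi := generators_basis h0X D_step D_multiple psiP.
split=> // k expansion; split=> [|F FE]; last first.
  split; first exact: (expansion_degree hXi h0X D_step D_multiple psiP).
  exact: (expansion_lead_unit hXi h0X D_step D_multiple psiP).
have /choice[f fE] : forall a : 'I_r, exists f : 'I_r -> {poly R[i]},
    section_eq (psi (k * r + a)%N) (polycomb Z f (fun j : 'I_r => psi j)).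
  move=> a; have [//|f _ fE] := polycomb_expansion (m := k.+1)
    (phi := psi (k * r + a)%N) hXi h0X D_step D_multiple basispsi; last by exists f.
  have [h _ _] := psiP (k * r + a)%N; apply: H0_le h; apply: (D_le D_step).
  by rewrite mulSn [(r + _)%N]addnC -addnS leq_add2l.
exists (\matrix_(a, j) f a j) => a i p ip; move: (fE a i p ip).
by apply: filterS => q ->; apply: eq_bigr => j _; rewrite mxE.
Qed.
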